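(* Let $\mathcal{B}$ be a binary relation on abstract local configurations, $\mathcal{R}$ a relation between abstract and concrete local configurations, $\mathcal{I}$ a binary relation on concrete local configurations, and $\mathit{abs\text{-}steps}$ a function assigning a natural number to each pair (abstract configuration, concrete configuration). If $\mathsf{secure\text{-}refinement\text{-}decomp}\ \mathcal{B}\ \mathcal{R}\ \mathcal{I}\ \mathit{abs\text{-}steps}$ holds, then $\mathsf{secure\text{-}refinement}\ \mathcal{B}\ \mathcal{R}\ \mathcal{I}$ holds.
   Context: Setting. Fix a type $\mathit{Val}$ of values and a finite set $\mathit{Var}$ of shared variables. Let $\mathit{Mode}=\{\mathbf{AsmNoW},\mathbf{AsmNoRW},\mathbf{GuarNoW},\mathbf{GuarNoRW}\}$. A mode state is a function $\mathit{mds}:\mathit{Mode}\to\mathcal{P}(\mathit{Var})$; a memory is a total function $\mathit{mem}:\mathit{Var}\to\mathit{Val}$. An abstract local configuration is a triple $\langle \mathit{tps},\mathit{mds},\mathit{mem}\rangle$ with $\mathit{tps}$ of some arbitrary type $T_A$ (thread-private state); a concrete local configuration is such a triple with $\mathit{tps}$ of some arbitrary type $T_C$. There is an abstract step relation $\rightsquigarrow_A$ on abstract configurations and a concrete step relation $\rightsquigarrow_C$ on concrete configurations, both deterministic (each configuration has at most one successor). $\rightsquigarrow_A^{n}$ denotes $n$-fold composition of $\rightsquigarrow_A$ ($n=0$ is identity). $\mathsf{stops}\ \mathit{lc}$ means there is no $\mathit{lc}'$ with $\mathit{lc}\rightsquigarrow_C \mathit{lc}'$. Fix a classification function $\mathcal{L}:(\mathit{Var}\to\mathit{Val})\to\mathit{Var}\to\{\mathrm{High},\mathrm{Low}\}$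 and a function $\mathcal{C}\mathsf{vars}:\mathit{Var}\to\mathcal{P}(\mathit{Var})$; let $\mathcal{C}=\{y\mid \exists x.\ y\in\mathcal{C}\mathsf{vars}\ x\}$. Define $\mathsf{readable}\ \mathit{mds}\ x \equiv x\notin \mathit{mds}\ \mathbf{AsmNoRW}$ and $\mathsf{writable}\ \mathit{mds}\ x\equiv x\notin\mathit{mds}\ \mathbf{AsmNoW}\wedge x\notin\mathit{mds}\ \mathbf{AsmNoRW}$. Memories are low-equivalent modulo $\mathit{mds}$, written $\mathit{mem}_1 =^{\mathrm{Low}}_{\mathit{mds}} \mathit{mem}_2$, iff for all $x$: if $x\in\mathcal{C}$ or ($\mathcal{L}\ \mathit{mem}_1\ x=\mathrm{Low}$ and $\mathsf{readable}\ \mathit{mds}\ x$) then $\mathit{mem}_1\ x=\mathit{mem}_2\ x$. For configurations (abstract or concrete), $\mathit{lc}_1 \sim_{\mathit{mds}} \mathit{lc}_2$ means they have equal mode states, and $\mathit{lc}_1\sim^{\mathit{mem}}_{\mathit{mds}}\mathit{lc}_2$ means they have equal mode states and equal memories. Definitions. - $\mathsf{preserves\text{-}modes\text{-}mem}\ \mathcal{R}$: for all $(\mathit{lc}_A,\mathit{lc}_C)\in\mathcal{R}$, $\mathit{lc}_A\sim^{\mathit{mem}}_{\mathit{mds}}\mathit{lc}_C$. - $\mathsf{closed\text{-}others}\ \mathcal{R}$: for all $\mathit{tps}_A,\mathit{tps}_C,\mathit{mds},\mathit{mem},\mathit{mem}'$: if $(\langle\mathit{tps}_A,\mathit{mds},\mathit{mem}\rangle,\langle\mathit{tps}_C,\mathit{mds},\mathit{mem}\rangle)\in\mathcal{R}$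 and for every $x$ with $\mathit{mem}\ x\ne\mathit{mem}'\ x$ or $\mathcal{L}\ \mathit{mem}\ x\neq\mathcal{L}\ \mathit{mem}'\ x$ we have $\mathsf{writable}\ \mathit{mds}\ x$, then $(\langle\mathit{tps}_A,\mathit{mds},\mathit{mem}'\rangle,\langle\mathit{tps}_C,\mathit{mds},\mathit{mem}'\rangle)\in\mathcal{R}$. - $\mathsf{cg\text{-}consistent}\ \mathcal{I}$: for all $\mathit{tps}_1,\mathit{mem}_1,\mathit{tps}_2,\mathit{mem}_2,\mathit{mds}$ with $(\langle\mathit{tps}_1,\mathit{mds},\mathit{mem}_1\rangle,\langle\mathit{tps}_2,\mathit{mds},\mathit{mem}_2\rangle)\in\mathcal{I}$, and all $\mathit{mem}_1',\mathit{mem}_2'$: if for every $x$ with $\mathit{mem}_1\ x\ne\mathit{mem}_1'\ x$ or $\mathit{mem}_2\ x\neq\mathit{mem}_2'\ x$ or $\mathcal{L}\ \mathit{mem}_1\ x\ne\mathcal{L}\ \mathit{mem}_1'\ x$ we have $\mathsf{writable}\ \mathit{mds}\ x$, and $\mathit{mem}_1' =^{\mathrm{Low}}_{\mathit{mds}}\mathit{mem}_2'$, then $(\langle\mathit{tps}_1,\mathit{mds},\mathit{mem}_1'\rangle,\langle\mathit{tps}_2,\mathit{mds},\mathit{mem}_2'\rangle)\in\mathcal{I}$. - $\mathsf{sym}\ \mathcal{I}$: $\mathcal{I}$ is symmetric. - $\mathsf{coupling\text{-}inv\text{-}pres}\ \mathcal{B}\ \mathcal{R}\ \mathcal{I}$: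 for all $(\mathit{lc}_{1A},\mathit{lc}_{1C})\in\mathcal{R}$ and all $\mathit{lc}_{1C}'$ with $\mathit{lc}_{1C}\rightsquigarrow_C\mathit{lc}_{1C}'$, there exist $n$ and $\mathit{lc}_{1A}'$ with $\mathit{lc}_{1A}\rightsquigarrow_A^{n}\mathit{lc}_{1A}'$, $(\mathit{lc}_{1A}',\mathit{lc}_{1C}')\in\mathcal{R}$, and such that for all $\mathit{lc}_{2A},\mathit{lc}_{2C},\mathit{lc}_{2A}'$: if $(\mathit{lc}_{1A},\mathit{lc}_{2A})\in\mathcal{B}$, $\mathit{lc}_{1A}\sim_{\mathit{mds}}\mathit{lc}_{2A}$, $(\mathit{lc}_{2A},\mathit{lc}_{2C})\in\mathcal{R}$, $(\mathit{lc}_{1C},\mathit{lc}_{2C})\in\mathcal{I}$, $\mathit{lc}_{1C}\sim_{\mathit{mds}}\mathit{lc}_{2C}$, $\mathit{lc}_{2A}\rightsquigarrow_A^{n}\mathit{lc}_{2A}'$ and $\mathit{lc}_{1A}'\sim_{\mathit{mds}}\mathit{lc}_{2A}'$, then there exists $\mathit{lc}_{2C}'$ with $\mathit{lc}_{2C}\rightsquigarrow_C\mathit{lc}_{2C}'$, $\mathit{lc}_{1C}'\sim_{\mathit{mds}}\mathit{lc}_{2C}'$, $(\mathit{lc}_{2A}',\mathit{lc}_{2C}')\in\mathcal{R}$ and $(\mathit{lc}_{1C}',\mathit{lc}_{2C}')\in\mathcal{I}$. - $\mathsf{secure\text{-}refinement}\ \mathcal{B}\ \mathcal{R}\ \mathcal{I}\equiv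 \mathsf{preserves\text{-}modes\text{-}mem}\ \mathcal{R}\wedge\mathsf{closed\text{-}others}\ \mathcal{R}\wedge\mathsf{cg\text{-}consistent}\ \mathcal{I}\wedge\mathsf{sym}\ \mathcal{I}\wedge\mathsf{coupling\text{-}inv\text{-}pres}\ \mathcal{B}\ \mathcal{R}\ \mathcal{I}$. - $\mathsf{decomp\text{-}refinement\text{-}safe}\ \mathcal{B}\ \mathcal{R}\ \mathcal{I}\ \mathit{abs\text{-}steps}$: for all $\mathit{lc}_{1A},\mathit{lc}_{2A},\mathit{lc}_{1C},\mathit{lc}_{2C}$ with $(\mathit{lc}_{1A},\mathit{lc}_{2A})\in\mathcal{B}$, $\mathit{lc}_{1A}\sim_{\mathit{mds}}\mathit{lc}_{2A}$, $(\mathit{lc}_{1A},\mathit{lc}_{1C})\in\mathcal{R}$, $(\mathit{lc}_{2A},\mathit{lc}_{2C})\in\mathcal{R}$, $(\mathit{lc}_{1C},\mathit{lc}_{2C})\in\mathcal{I}$ and $\mathit{lc}_{1C}\sim_{\mathit{mds}}\mathit{lc}_{2C}$: (i) $\mathsf{stops}\ \mathit{lc}_{1C}\iff\mathsf{stops}\ \mathit{lc}_{2C}$; (ii) $\mathit{abs\text{-}steps}\ \mathit{lc}_{1A}\ \mathit{lc}_{1C}=\mathit{abs\text{-}steps}\ \mathit{lc}_{2A}\ \mathit{lc}_{2C}$; (iii) for all $\mathit{lc}_{1C}',\mathit{lc}_{2C}'$ with $\mathit{lc}_{1C}\rightsquigarrow_C\mathit{lc}_{1C}'$ and $\mathit{lc}_{2C}\rightsquigarrow_C\mathit{lc}_{2C}'$,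 we have $(\mathit{lc}_{1C}',\mathit{lc}_{2C}')\in\mathcal{I}$ and $\mathit{lc}_{1C}'\sim_{\mathit{mds}}\mathit{lc}_{2C}'$. - $\mathsf{secure\text{-}refinement\text{-}decomp}\ \mathcal{B}\ \mathcal{R}\ \mathcal{I}\ \mathit{abs\text{-}steps}\equiv \mathsf{preserves\text{-}modes\text{-}mem}\ \mathcal{R}\wedge\mathsf{closed\text{-}others}\ \mathcal{R}\wedge\mathsf{cg\text{-}consistent}\ \mathcal{I}\wedge\mathsf{sym}\ \mathcal{I}\wedge\mathsf{decomp\text{-}refinement\text{-}safe}\ \mathcal{B}\ \mathcal{R}\ \mathcal{I}\ \mathit{abs\text{-}steps}\ \wedge$ (for all $(\mathit{lc}_A,\mathit{lc}_C)\in\mathcal{R}$ and all $\mathit{lc}_C'$ with $\mathit{lc}_C\rightsquigarrow_C\mathit{lc}_C'$, there exists $\mathit{lc}_A'$ with $\mathit{lc}_A\rightsquigarrow_A^{\mathit{abs\text{-}steps}\ \mathit{lc}_A\ \mathit{lc}_C}\mathit{lc}_A'$ and $(\mathit{lc}_A',\mathit{lc}_C')\in\mathcal{R}$). *)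

(* Defs.v *)
From mathcomp Require Import all_boot.
From Corelib Require RelationClasses.

Set Implicit Arguments.
Unset Strict Implicit.
Unset Printing Implicit Defensive.

Inductive mode := AsmNoW | AsmNoRW | GuarNoW | GuarNoRW.

Inductive level := High | Low.

Definition mode_state (Var : finType) := mode -> {set Var}.

Definition memory (Val : Type) (Var : finType) := Var -> Val.

Record lconf (Val : Type) (Var : finType) (T : Type) := LConf {
  tps : T;
  mds : mode_state Var;
  mem : memory Val Var
}.

Definition same_mds (Val : Type) (Var : finType) (T T' : Type)
    (lc : lconf Val Var T) (lc' : lconf Val Var T') : Prop :=
  mds lc = mds lc'.

Definition same_mds_mem (Val : Type) (Var : finType) (T T' : Type)
    (lc : lconf Val Var T) (lc' : lconf Val Var T') : Prop :=
  mds lc = mds lc' /\ mem lc = mem lc'.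

Definition deterministic (S : Type) (step : S -> S -> Prop) : Prop :=
  forall s s1 s2, step s s1 -> step s s2 -> s1 = s2.

Fixpoint nsteps (S : Type) (step : S -> S -> Prop) (n : nat) (s s' : S) : Prop :=
  if n is n'.+1 then exists t, step s t /\ nsteps step n' t s' else s = s'.

Definition stops (S : Type) (step : S -> S -> Prop) (s : S) : Prop :=
  ~ exists s', step s s'.

Definition readable (Var : finType) (m : mode_state Var) (x : Var) : bool :=
  x \notin m AsmNoRW.

Definition writable (Var : finType) (m : mode_state Var) (x : Var) : bool :=
  (x \notin m AsmNoW) && (x \notin m AsmNoRW).

Definition control_vars (Var : finType) (Cvars : Var -> {set Var}) : {set Var} :=
  [set y | [exists x, y \in Cvars x]].

Definition low_eq (Val : Type) (Var : finType)
    (L : memory Val Var -> Var -> level) (Cvars : Var -> {set Var})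
    (m : mode_state Var) (mem1 mem2 : memory Val Var) : Prop :=
  forall x, x \in control_vars Cvars \/ (L mem1 x = Low /\ readable m x) ->
    mem1 x = mem2 x.

Definition preserves_modes_mem (Val : Type) (Var : finType) (TA TC : Type)
    (R : lconf Val Var TA -> lconf Val Var TC -> Prop) : Prop :=
  forall lcA lcC, R lcA lcC -> same_mds_mem lcA lcC.

Definition closed_others (Val : Type) (Var : finType) (TA TC : Type)
    (L : memory Val Var -> Var -> level)
    (R : lconf Val Var TA -> lconf Val Var TC -> Prop) : Prop :=
  forall (tA : TA) (tC : TC) (m : mode_state Var) (mem mem' : memory Val Var),
    R (LConf tA m mem) (LConf tC m mem) ->
    (forall x, mem x <> mem' x \/ L mem x <> L mem' x -> writable m x) ->
    R (LConf tA m mem') (LConf tC m mem').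

(* The hypothesis on changed variables mentions the classification in the first
   memory only: this asymmetry is intended. *)
Definition cg_consistent (Val : Type) (Var : finType) (T : Type)
    (L : memory Val Var -> Var -> level) (Cvars : Var -> {set Var})
    (I : lconf Val Var T -> lconf Val Var T -> Prop) : Prop :=
  forall (t1 : T) (mem1 : memory Val Var) (t2 : T) (mem2 : memory Val Var)
         (m : mode_state Var),
    I (LConf t1 m mem1) (LConf t2 m mem2) ->
    forall mem1' mem2' : memory Val Var,
      (forall x, mem1 x <> mem1' x \/ mem2 x <> mem2' x \/ L mem1 x <> L mem1' x ->
         writable m x) ->
      low_eq L Cvars m mem1' mem2' ->
      I (LConf t1 m mem1') (LConf t2 m mem2').

Definition coupling_inv_pres (Val : Type) (Var : finType) (TA TC : Type)
    (stepA : lconf Val Var TA -> lconf Val Var TA -> Prop)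
    (stepC : lconf Val Var TC -> lconf Val Var TC -> Prop)
    (B : lconf Val Var TA -> lconf Val Var TA -> Prop)
    (R : lconf Val Var TA -> lconf Val Var TC -> Prop)
    (I : lconf Val Var TC -> lconf Val Var TC -> Prop) : Prop :=
  forall lc1A lc1C, R lc1A lc1C ->
  forall lc1C', stepC lc1C lc1C' ->
  exists (n : nat) (lc1A' : lconf Val Var TA),
    [/\ nsteps stepA n lc1A lc1A',
        R lc1A' lc1C' &
        forall lc2A lc2C lc2A',
          B lc1A lc2A -> same_mds lc1A lc2A ->
          R lc2A lc2C ->
          I lc1C lc2C -> same_mds lc1C lc2C ->
          nsteps stepA n lc2A lc2A' -> same_mds lc1A' lc2A' ->
          exists lc2C', [/\ stepC lc2C lc2C', same_mds lc1C' lc2C',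
                            R lc2A' lc2C' & I lc1C' lc2C']].

Definition secure_refinement (Val : Type) (Var : finType) (TA TC : Type)
    (L : memory Val Var -> Var -> level) (Cvars : Var -> {set Var})
    (stepA : lconf Val Var TA -> lconf Val Var TA -> Prop)
    (stepC : lconf Val Var TC -> lconf Val Var TC -> Prop)
    (B : lconf Val Var TA -> lconf Val Var TA -> Prop)
    (R : lconf Val Var TA -> lconf Val Var TC -> Prop)
    (I : lconf Val Var TC -> lconf Val Var TC -> Prop) : Prop :=
  [/\ preserves_modes_mem R,
      closed_others L R,
      cg_consistent L Cvars I,
      RelationClasses.Symmetric I &
      coupling_inv_pres stepA stepC B R I].

Definition decomp_refinement_safe (Val : Type) (Var : finType) (TA TC : Type)
    (stepC : lconf Val Var TC -> lconf Val Var TC -> Prop)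
    (B : lconf Val Var TA -> lconf Val Var TA -> Prop)
    (R : lconf Val Var TA -> lconf Val Var TC -> Prop)
    (I : lconf Val Var TC -> lconf Val Var TC -> Prop)
    (abs_steps : lconf Val Var TA -> lconf Val Var TC -> nat) : Prop :=
  forall lc1A lc2A lc1C lc2C,
    B lc1A lc2A -> same_mds lc1A lc2A ->
    R lc1A lc1C -> R lc2A lc2C ->
    I lc1C lc2C -> same_mds lc1C lc2C ->
    [/\ stops stepC lc1C <-> stops stepC lc2C,
        abs_steps lc1A lc1C = abs_steps lc2A lc2C &
        forall lc1C' lc2C', stepC lc1C lc1C' -> stepC lc2C lc2C' ->
          I lc1C' lc2C' /\ same_mds lc1C' lc2C'].

Definition secure_refinement_decomp (Val : Type) (Var : finType) (TA TC : Type)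
    (L : memory Val Var -> Var -> level) (Cvars : Var -> {set Var})
    (stepA : lconf Val Var TA -> lconf Val Var TA -> Prop)
    (stepC : lconf Val Var TC -> lconf Val Var TC -> Prop)
    (B : lconf Val Var TA -> lconf Val Var TA -> Prop)
    (R : lconf Val Var TA -> lconf Val Var TC -> Prop)
    (I : lconf Val Var TC -> lconf Val Var TC -> Prop)
    (abs_steps : lconf Val Var TA -> lconf Val Var TC -> nat) : Prop :=
  preserves_modes_mem R /\
  closed_others L R /\
  cg_consistent L Cvars I /\
  RelationClasses.Symmetric I /\
  decomp_refinement_safe stepC B R I abs_steps /\
  (forall lcA lcC, R lcA lcC ->
   forall lcC', stepC lcC lcC' ->
   exists lcA', nsteps stepA (abs_steps lcA lcC) lcA lcA' /\ R lcA' lcC').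

(* Main.v *)
Require Import Defs.
From mathcomp Require Import all_boot.
From Stdlib Require Import Classical.

(** The pacing [abs_steps] chosen for the first run also serves the second: [decomp_refinement_safe]
    makes related runs stop together, agree on [abs_steps] and step to [I]-related states. The
    one-run simulation, applied to the second run, gives an [R]-related abstract state, and
    [nsteps_deterministic] shows it is the prescribed one. *)

Lemma nsteps_deterministic (S : Type) (step : S -> S -> Prop) (n : nat) :
  deterministic step -> deterministic (nsteps step n).
Proof.
move=> det; elim: n => [|n IHn] s s1 s2 /=; first by move=> <- <-.
move=> [t1 [st1 ts1]] [t2 [st2 ts2]].
by apply: IHn ts1 _; rewrite (det _ _ _ st1 st2).
Qed.

Theorem theorem9 (Val : Type) (Var : finType) (TA TC : Type)
    (L : memory Val Var -> Var -> level) (Cvars : Var -> {set Var})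
    (stepA : lconf Val Var TA -> lconf Val Var TA -> Prop)
    (stepC : lconf Val Var TC -> lconf Val Var TC -> Prop)
    (detA : deterministic stepA) (detC : deterministic stepC)
    (B : lconf Val Var TA -> lconf Val Var TA -> Prop)
    (R : lconf Val Var TA -> lconf Val Var TC -> Prop)
    (I : lconf Val Var TC -> lconf Val Var TC -> Prop)
    (abs_steps : lconf Val Var TA -> lconf Val Var TC -> nat) :
  secure_refinement_decomp L Cvars stepA stepC B R I abs_steps ->
  secure_refinement L Cvars stepA stepC B R I.
Proof.
move=> [presR [closR [cgI [symI [safe sim]]]]]; split=> //.
move=> lc1A lc1C R1 lc1C' step1; have [lc1A' [steps1 R1']] := sim _ _ R1 _ step1.
exists (abs_steps lc1A lc1C), lc1A'; split=> //.
move=> lc2A lc2C lc2A' B12 mdsA R2 I12 mdsC steps2 _.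
have [[_ stops21] eq_n next] := safe _ _ _ _ B12 mdsA R1 R2 I12 mdsC.
have [lc2C' step2] : exists lc2C', stepC lc2C lc2C'.
  (* [stops] only denies a successor, so extracting one is classical: if [lc2C] were stuck, [lc1C]
     would be too, against [step1]. *)
  by apply: NNPP => /stops21; apply; exists lc1C'.
have [I12' mdsC'] := next _ _ step1 step2.
exists lc2C'; split=> //.
(* Both runs take the same number of abstract steps, so determinism identifies
   the given [lc2A'] with the abstract state that simulates [lc2C']. *)
have [lcA [stepsA RA]] := sim _ _ R2 _ step2.
rewrite eq_n in steps2.
by rewrite (nsteps_deterministic _ _ _ detA _ _ _ steps2 stepsA).
Qed.
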